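(* $t(4)=7$.
   Context: Let $\mathfrak{C}=\{0,1\}^n$ be the vertex set of the $n$-dimensional hypercube; $\oplus,\wedge$ denote bitwise XOR and AND. An outmap is any function $s:\mathfrak{C}\to\{0,1\}^n$. A clash of $s$ is a pair of distinct vertices $u,v$ with $(s(u)\oplus s(v))\wedge(u\oplus v)=0^n$. A query at $u$ to the oracle for $s$ returns $s(u)$; algorithms choose queries adaptively, and only the number of queries is counted. \textsc{Sink-or-Clash}: given oracle access to an arbitrary outmap $s$, query either a vertex $u$ with $s(u)=0^n$ or both vertices of some clash. $t(n)=\min_{\mathcal A}\max_s t(\mathcal A,s)$, where $\mathcal A$ ranges over deterministic algorithms solving \textsc{Sink-or-Clash} on all outmaps of the $n$-cube and $t(\mathcal A,s)$ is the number of queries made on $s$. *)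

(* Defs.v *)
From mathcomp Require Import all_boot.
From mathcomp Require Import boolp.
Set Implicit Arguments.
Unset Strict Implicit.
Unset Printing Implicit Defensive.

Definition cube (n : nat) := n.-tuple bool.

Definition zerov (n : nat) : cube n := [tuple false | i < n].
Definition xorv (n : nat) (u v : cube n) : cube n :=
  [tuple tnth u i (+) tnth v i | i < n].
Definition andv (n : nat) (u v : cube n) : cube n :=
  [tuple tnth u i && tnth v i | i < n].

Definition outmap (n : nat) := {ffun cube n -> cube n}.

Definition is_sink (n : nat) (s : outmap n) (u : cube n) : bool :=
  s u == zerov n.

Definition is_clash (n : nat) (s : outmap n) (u v : cube n) : bool :=
  (u != v) && (andv (xorv (s u) (s v)) (xorv u v) == zerov n).

(* A deterministic adaptive algorithm is a decision tree: it either halts, or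
   queries a vertex u and continues in a way that depends on the answer s u.
   Every branch of the tree is finite, so the algorithm halts on every outmap.
   Nothing is output: the task is only to query a sink or both ends of a clash. *)
Inductive algorithm (n : nat) : Type :=
  | Halt
  | Query of cube n & (cube n -> algorithm n).
Arguments Halt {n}.

Fixpoint queried (n : nat) (A : algorithm n) (s : outmap n) : seq (cube n) :=
  if A is Query u k then u :: queried (k (s u)) s else [::].

(* Repeated queries of a vertex count each time. *)
Definition query_count (n : nat) (A : algorithm n) (s : outmap n) : nat :=
  size (queried A s).

Definition solves_on (n : nat) (A : algorithm n) (s : outmap n) : Prop :=
  (exists2 u, u \in queried A s & is_sink s u) \/
  (exists u v, [/\ u \in queried A s, v \in queried A s & is_clash s u v]).

Definition solves_sink_or_clash (n : nat) (A : algorithm n) : Prop :=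
  forall s : outmap n, solves_on A s.

Definition worst_case (n : nat) (A : algorithm n) : nat :=
  \max_(s : outmap n) query_count A s.

Definition achievable (n m : nat) : Prop :=
  exists2 A : algorithm n, solves_sink_or_clash A & worst_case A = m.

Fixpoint query_all (n : nat) (us : seq (cube n)) : algorithm n :=
  if us is u :: us' then Query u (fun=> query_all us') else Halt.

Lemma queried_all (n : nat) (us : seq (cube n)) (s : outmap n) :
  queried (query_all us) s = us.
Proof. by elim: us => //= u us ->. Qed.

(* A clash-free outmap is injective, hence onto, hence has a sink. *)
Lemma query_all_solves (n : nat) :
  solves_sink_or_clash (query_all (enum {: cube n})).
Proof.
move=> s; rewrite /solves_on queried_all.
case: (boolP [exists u, exists v, is_clash s u v]) => [|noclash].
  move=> /existsP[u /existsP[v uv]]; right.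
  by exists u, v; split; rewrite ?mem_enum.
have inj_s : injective s.
  move=> u v suv; apply/eqP; apply: contraNT noclash => neq_uv.
  apply/existsP; exists u; apply/existsP; exists v; rewrite /is_clash neq_uv /=.
  by apply/eqP/eq_from_tnth => i; rewrite !tnth_mktuple suv addbb.
have [g _ gK] := injF_bij inj_s.
by left; exists (g (zerov n)); rewrite ?mem_enum // /is_sink gK.
Qed.

Lemma achievable_ex (n : nat) : exists m, `[< achievable n m >].
Proof.
exists (worst_case (query_all (enum {: cube n}))); apply/asboolP.
by exists (query_all (enum {: cube n})) => //; exact: query_all_solves.
Qed.

Definition t (n : nat) : nat := ex_minn (achievable_ex n).

(* Main.v *)
(* Upper bound: a finite search tree of depth 7 for the algorithm, in which every
   answer that is a sink or creates a clash ends the branch.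
   Lower bound: a finite tree for the adversary. Having answered 1111 to the first
   query (the game is invariant under translations of the vertices), it survives
   five more queries without ever answering 0000 or creating a clash. Revealing
   the answers at further vertices for free only helps the algorithm but keeps the
   adversary's tree small: as soon as the queried vertices of a facet all point
   out of it and the others have no outgoing edge in that direction, the adversary
   may reveal the whole facet, and the hidden part is a cube of lower dimension.
   The trees are produced by unverified searches; only their checkers [wins] and
   [evades] are proved sound. *)
Require Import Defs.
From mathcomp Require Import all_boot.
From mathcomp Require Import boolp.
Set Implicit Arguments.
Unset Strict Implicit.
Unset Printing Implicit Defensive.

(** * Certificate trees and their checkers *)

Fixpoint words (n : nat) : seq bitseq :=
  if n is n'.+1 then map (cons false) (words n') ++ map (cons true) (words n')
  else [:: [::]].

(* A queried vertex and its answer. *)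
Definition entry := (bitseq * bitseq)%type.

(* Nested conditionals, unlike [&&] and [||], stop early under call by value. *)
Fixpoint differ (u v a b : bitseq) : bool :=
  match u, v, a, b with
  | x :: u', y :: v', p :: a', q :: b' =>
      if (x (+) y) && (p (+) q) then true else differ u' v' a' b'
  | _, _, _, _ => false
  end.

Definition apart (p q : entry) : bool := differ p.1 q.1 p.2 q.2.

Inductive strategy := Ask of bitseq & seq (bitseq * strategy).

Definition answered (b : bitseq) (Ts : seq (bitseq * strategy)) : strategy :=
  nth (Ask [::] [::]) (unzip2 Ts) (index b (unzip1 Ts)).

Fixpoint wins (n k : nat) (T : strategy) (st : seq entry) : bool :=
  if k is k'.+1 then
    let: Ask u Ts := T in
    [&& size u == n, u \notin unzip1 st &
      all (fun b =>
        if has id b && all (apart (u, b)) st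
        then wins n k' (answered b Ts) ((u, b) :: st)
        else true) (words n)]
  else false.

(* Each child reveals a list of answers, which serves any query among them. *)
Inductive evasion := Evade of seq (seq entry * evasion).

(** Distinctness of the vertices is implied: [apart] fails on two entries with the same vertex. *)
Definition legal (n : nat) (st : seq entry) : bool :=
  all (fun p => (size p.2 == n) && has id p.2) st && pairwise apart st.

Fixpoint evades (n k : nat) (T : evasion) (st : seq entry) : bool :=
  if k is k'.+1 then
    let: Evade es := T in
    all (fun u => (u \in unzip1 st) || has (fun e => u \in unzip1 e.1) es)
        (words n) &&
    all (fun e => legal n (e.1 ++ st) && evades n k' e.2 (e.1 ++ st)) es
  else true.

(** * Unverified searches for the two trees *)

Fixpoint first_some (A B : Type) (f : A -> option B) (s : seq A) : option B :=
  if s is x :: s' then if f x is Some y then Some y else first_some f s'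
  else None.

Fixpoint all_some (A B : Type) (f : A -> option B) (s : seq A) :
    option (seq (A * B)) :=
  if s is x :: s' then
    if f x is Some y then
      if all_some f s' is Some r then Some ((x, y) :: r) else None
    else None
  else Some [::].

(* [rest] lists each unqueried vertex with its possible nonzero answers. *)
Definition restrict (p : entry) (rest : seq (bitseq * seq bitseq)) :=
  [seq (r.1, [seq b <- r.2 | apart p (r.1, b)]) | r <- rest & r.1 != p.1].

(** A vertex with no answer left wins at once, since every answer is a sink or clashes with an
    earlier one. This last query has to be paid for, so branching needs [k >= 2]. *)
Fixpoint find_strategy (k : nat) (rest : seq (bitseq * seq bitseq)) :
    option strategy :=
  if first_some (fun r => if r.2 is [::] then Some r.1 else None) rest is Some u
  then Some (Ask u [::])
  else if k is (k'.+1 as k1).+1 then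
    first_some (fun r =>
      if all_some (fun b => find_strategy k1 (restrict (r.1, b) rest)) r.2
      is Some Ts then Some (Ask r.1 Ts) else None) rest
  else None.

(* [behead (words n)] lists the nonzero words. The rotation makes the search try
   1111 and then its antipode 0000 first, after which 7 queries always suffice. *)
Definition strategy4 := Eval vm_compute in
  odflt (Ask [::] [::])
    (find_strategy 7 [seq (u, behead (words 4)) | u <- rotr 1 (words 4)]).

Lemma strategy4_wins : wins 4 7 strategy4 [::].
Proof. by vm_compute. Qed.

(** Greedy: a vertex without an admissible answer is skipped and left to another child. *)
Fixpoint reveal (ok : pred bitseq) (bs us : seq bitseq) (st new : seq entry) :
    seq entry :=
  if us is u :: us' then
    if u \in unzip1 (new ++ st) then reveal ok bs us' st new
    else let c := [seq b <- bs | ok b && all (apart (u, b)) (new ++ st)] in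
         reveal ok bs us' st (if c is b :: _ then (u, b) :: new else new)
  else new.

(* Besides [p] alone, the candidate revelations are the facets through [p.1] such
   that all known answers are compatible with every edge in the direction normal
   to the facet pointing out of it. *)
Definition extensions (n k : nat) (bs : seq bitseq) (st : seq entry) (p : entry) :=
  if k is 0 then [:: reveal predT bs (words n) st [:: p]]
  else
    [seq reveal (nth false ^~ i) bs
           [seq v <- words n | nth false v i == nth false p.1 i] st [:: p]
       | i <- iota 0 n &
         all (fun q => (nth false q.1 i == nth false p.1 i) == nth false q.2 i)
             (p :: st)]
    ++ [:: [:: p]].

Fixpoint find_evasion (n k : nat) (st : seq entry) : option evasion :=
  if k is k'.+1 then
    let bs := rev (behead (words n)) in
    let fix cover us es :=
      if us is u :: us' then
        if u \in unzip1 (flatten (st :: unzip1 es)) then cover us' es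
        else if first_some (fun b =>
            if all (apart (u, b)) st then
              first_some (fun new =>
                  if find_evasion n k' (new ++ st) is Some T then Some (new, T)
                  else None)
                (extensions n k' bs st (u, b))
            else None) bs is Some e
          then cover us' (e :: es) else None
      else Some (Evade es) in
    cover (words n) [::]
  else Some (Evade [::]).

Definition initial (n : nat) : seq entry := [:: (nseq n false, nseq n true)].

Definition evasion4 := Eval vm_compute in
  odflt (Evade [::]) (find_evasion 4 5 (initial 4)).

Lemma evasion4_evades : evades 4 5 evasion4 (initial 4).
Proof. by vm_compute. Qed.

(** * From words to vertices of the cube *)

Lemma mem_words (n : nat) (u : n.-tuple bool) : val u \in words n.
Proof.
elim: n u => [|n IHn] u; first by rewrite (tuple0 u).
case: (tupleP u) => b v /=; rewrite mem_cat.
by case: b; rewrite (map_f (cons _) (IHn v)) ?orbT.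
Qed.

Lemma has_idE (n : nat) (a : cube n) : has id a = (a != zerov n).
Proof.
apply/idP/idP => [/(has_nthP false)[i]|].
  rewrite size_tuple => ltin ai; apply: contraTneq ai => ->.
  by rewrite -(tnth_nth false _ (Ordinal ltin)) tnth_mktuple.
apply: contraNT => /hasPn noa; apply/eqP/eq_from_tnth => i.
by rewrite tnth_mktuple; apply/negbTE/noa/mem_tnth.
Qed.

Lemma differP (n : nat) (u v a b : n.-tuple bool) :
  reflect (exists i, (tnth u i (+) tnth v i) && (tnth a i (+) tnth b i))
          (differ u v a b).
Proof.
elim: n u v a b => [|n IHn] u v a b.
  by rewrite (tuple0 u); right=> -[[]].
case: (tupleP u) => x u'; case: (tupleP v) => y v'.
case: (tupleP a) => p a'; case: (tupleP b) => q b' /=.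
case: ifP => [xy | nxy]; first by left; exists ord0; rewrite !tnth0.
apply: (iffP (IHn u' v' a' b')) => -[i].
  by move=> ui; exists (lift ord0 i); rewrite !tnthS.
case: (unliftP ord0 i) => [j|] ->; first by rewrite !tnthS; exists j.
by rewrite !tnth0 nxy.
Qed.

Lemma differE (n : nat) (u v a b : cube n) :
  differ u v a b = (andv (xorv a b) (xorv u v) != zerov n).
Proof.
apply/differP/idP => [[i ui] | ].
  apply: contraTneq ui => /(congr1 (fun w => tnth w i)).
  by rewrite !tnth_mktuple andbC => ->.
apply: contraNP => nou; apply/eqP/eq_from_tnth => i; rewrite !tnth_mktuple.
by apply/negbTE/negP; rewrite andbC => ui; apply: nou; exists i.
Qed.

Lemma is_clashE (n : nat) (s : outmap n) (u v : cube n) :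
  is_clash s u v = (u != v) && ~~ differ u v (s u) (s v).
Proof. by rewrite differE negbK. Qed.

(** The goal of [solves_on] for any list, so that an induction can count the vertices queried
    earlier. *)
Definition found (n : nat) (s : outmap n) (vs : seq (cube n)) : Prop :=
  (exists2 u, u \in vs & is_sink s u) \/
  (exists u v, [/\ u \in vs, v \in vs & is_clash s u v]).

Lemma wins_sound (n k : nat) (T : strategy) (st : seq entry) :
  wins n k T st -> exists A : algorithm n, forall (s : outmap n) vs,
    st = [seq (val v, val (s v)) | v <- vs] ->
    query_count A s <= k /\ found s (vs ++ queried A s).
Proof.
elim: k T st => [|k IHk] // [u Ts] st /= /and3P[/eqP su].
have -> : u = tval (Tuple (introT eqP su)) by [].
move: (Tuple _) => {su}u u_new /allP win.
pose ok b := has id b && all (apart (val u, b)) st.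
(* Finite choice turns the subtrees into one continuation [f], which halts on the answers that
   already give a sink or a clash. *)
have /fin_all_exists[f fP] (b : cube n) : exists A : algorithm n,
    if ok (val b) then forall (s : outmap n) vs,
      (val u, val b) :: st = [seq (val v, val (s v)) | v <- vs] ->
      query_count A s <= k /\ found s (vs ++ queried A s)
    else A = Halt.
  have := win _ (mem_words b); rewrite -/(ok (val b)).
  case: (ok _) =>  [/IHk // | _].
  by exists Halt.
exists (Query u f) => s vs st_vs.
have u_notin : u \notin vs.
  apply: contra u_new => uvs; rewrite st_vs.
  by apply/mapP; exists (val u, val (s u)) => //; apply/mapP; exists u.
have := fP (s u); case: ifP => [_ fs | nok halt]; rewrite /query_count /=.
  have [|leAk fA] := fs s (u :: vs); first by rewrite st_vs.
  split; first by rewrite ltnS.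
  have perm w : w \in (u :: vs) ++ queried (f (s u)) s ->
      w \in vs ++ u :: queried (f (s u)) s.
    by rewrite !(mem_cat, inE) orbCA orbA.
  by case: fA => [[w /perm] | [w [w' [/perm ? /perm]]]];
    [left; exists w | right; exists w, w'].
rewrite halt; split=> //; move/negbT: nok; rewrite negb_and has_idE negbK.
case/orP => [sink | /allPn[p]].
  by left; exists u => //; rewrite mem_cat mem_head orbT.
rewrite st_vs => /mapP[v v_vs ->{p}] clash; right; exists u, v.
split; rewrite ?mem_cat ?mem_head ?v_vs ?orbT // is_clashE clash andbT.
by apply: contraNneq u_notin => ->.
Qed.

(** * Soundness of the adversary's tree *)

Definition shift (n : nat) (t v : cube n) : bitseq := val (xorv t v).

Lemma xorv_inj (n : nat) (t : cube n) : injective (xorv t).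
Proof.
move=> u v eq_uv; apply/eq_from_tnth => i.
have := congr1 (fun w => tnth w i) eq_uv; rewrite !tnth_mktuple.
exact: addbI.
Qed.

Lemma shift_self (n : nat) (t : cube n) : shift t t = nseq n false.
Proof.
rewrite /shift; have -> // : xorv t t = [tuple of nseq n false].
by apply/eq_from_tnth => i; rewrite tnth_mktuple addbb tnth_nseq.
Qed.

(** [t] cancels in the XOR of two vertices: the game is translation invariant. *)
Lemma differ_shift (n : nat) (t u v a b : cube n) :
  differ (shift t u) (shift t v) a b = differ u v a b.
Proof.
apply/differP/differP => -[i ui]; exists i; move: ui; rewrite !tnth_mktuple;
  by rewrite addbACA addbb.
Qed.

Lemma differC u v a b : differ u v a b = differ v u b a.
Proof.
elim: u v a b => [|x u IHu] [|y v] [|p a] [|q b] //=.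
by rewrite IHu (addbC x) (addbC p).
Qed.

Lemma apart_irr (u a b : bitseq) : apart (u, a) (u, b) = false.
Proof.
rewrite /apart /=.
by elim: u a b => [|x u IHu] [|p a] [|q b] //=; rewrite addbb IHu.
Qed.

Lemma legal_apart (n : nat) (st : seq entry) (p q : entry) :
  legal n st -> p \in st -> q \in st -> p = q \/ apart p q.
Proof.
case/andP=> _; elim: st => //= r st IHst /andP[/allP r_st /IHst IH].
rewrite !inE => /predU1P[-> | p_st] /predU1P[-> | q_st]; first by left.
- by right; apply: r_st.
- by right; rewrite /apart differC; apply: r_st.
exact: IH.
Qed.

Lemma legal_fun (n : nat) (st : seq entry) (u a b : bitseq) :
  legal n st -> (u, a) \in st -> (u, b) \in st -> a = b.
Proof.
by move=> st_ok ua ub; have [[]|] := legal_apart st_ok ua ub;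
  rewrite // apart_irr.
Qed.

Lemma legal_size (n : nat) (st : seq entry) (p : entry) :
  legal n st -> p \in st -> size p.2 == n.
Proof. by case/andP=> /allP st_ok _ /st_ok/andP[]. Qed.

(* The positions of the adversary are relative to [t], the first vertex that the
   algorithm queries. *)
Definition agrees (n : nat) (t : cube n) (st : seq entry) (s : outmap n) :=
  forall v b, (shift t v, b) \in st -> val (s v) = b.

Lemma agrees_ex (n : nat) (t : cube n) (st : seq entry) :
  legal n st -> exists s : outmap n, agrees t st s.
Proof.
move=> st_ok.
have /fin_all_exists[f fP] (v : cube n) :
    exists a : cube n, forall b, (shift t v, b) \in st -> val a = b.
  have [/mapP[[w b] /= wb def_w] | nov] := boolP (shift t v \in unzip1 st).
    exists (Tuple (legal_size st_ok wb)) => c; rewrite def_w /=.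
    exact: legal_fun st_ok wb.
  exists (zerov n) => b vb; case/negP: nov.
  by apply/mapP; exists (shift t v, b).
by exists (finfun f) => v b; rewrite ffunE; apply: fP.
Qed.

(** Induction on [A]: the adversary's answers fix a path through [A] before any outmap is chosen,
    and each agreeing outmap within the budget follows it. *)
Lemma evades_sound (n k : nat) (T : evasion) (st : seq entry) (t : cube n)
    (A : algorithm n) :
  legal n st -> evades n k T st ->
  exists st', [/\ legal n st', {subset st <= st'} &
    forall s : outmap n, agrees t st' s -> query_count A s <= k ->
    {subset [seq shift t v | v <- queried A s] <= unzip1 st'}].
Proof.
elim: A k T st => [|u f IHf] k T st st_ok ev.
  by exists st; split=> // s _ _ v.
have [k0 | not_k0] := boolP ((k == 0) && (shift t u \notin unzip1 st)).
  by exists st; split=> // s _; case/andP: k0 => /eqP->.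
(* Querying a revealed vertex keeps position and budget, a fresh query moves to a child;
   [m < k -> m <= k1] covers both. *)
have [st1 [k1 [T1 [st1_ok sub ev1 u_st1 lek1]]]] : exists st1 k1 T1,
    [/\ legal n st1, {subset st <= st1}, evades n k1 T1 st1,
        shift t u \in unzip1 st1 & forall m, m < k -> m <= k1].
  have [u_st | u_new] := boolP (shift t u \in unzip1 st).
    by exists st, k, T; split=> // m /ltnW.
  rewrite u_new andbT in not_k0.
  case: k T ev not_k0 => [|k] [es] //.
  case/andP=> /allP/(_ _ (mem_words (xorv t u))) + es_ok _.
  rewrite (negbTE u_new) => /(has_nthP ([::], Evade [::]))[i lti].
  have /andP[] := all_nthP ([::], Evade [::]) es_ok i lti.
  move: (nth _ es i) => e e_ok ev_e u_e.
  exists (e.1 ++ st), k, e.2; split=> // [p p_st|].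
    by rewrite mem_cat p_st orbT.
  by rewrite /unzip1 map_cat mem_cat; apply/orP; left.
case/mapP: u_st1 => -[w b] /= wb def_w; rewrite -{w}def_w in wb.
have [st' [st'_ok sub' IH]] :=
  IHf (Tuple (legal_size st1_ok wb)) _ _ _ st1_ok ev1.
exists st'; split=> // [p /sub/sub' // | s s_st' le_k v].
have su : s u = Tuple (legal_size st1_ok wb).
  exact/val_inj/s_st'/sub'.
rewrite /= inE su => /predU1P[-> | v_q].
  by apply/mapP; exists (shift t u, b) => //; apply: sub'.
apply: IH v_q => //; apply: lek1.
by rewrite -su.
Qed.

Lemma legal_not_found (n : nat) (t : cube n) (st : seq entry) (s : outmap n)
    (vs : seq (cube n)) :
  legal n st -> agrees t st s ->
  {subset [seq shift t v | v <- vs] <= unzip1 st} -> ~ found s vs.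
Proof.
move=> st_ok s_st vs_st.
have entry_of v : v \in vs -> (shift t v, val (s v)) \in st.
  move=> /(map_f (shift t))/vs_st/mapP[[w b] /= wb def_w].
  by rewrite -def_w in wb; rewrite (s_st _ _ wb).
case=> [[v /entry_of v_st] | [u [v [/entry_of u_st /entry_of v_st]]]].
  by case/andP: st_ok => /allP/(_ _ v_st)/andP[_]; rewrite has_idE => /negP.
rewrite is_clashE => /andP[neq_uv].
have [[/val_inj/xorv_inj eq_uv _] | ] := legal_apart st_ok u_st v_st.
  by rewrite eq_uv eqxx in neq_uv.
by rewrite /apart /= differ_shift => ->.
Qed.

Lemma t_le (n k : nat) (A : algorithm n) :
  solves_sink_or_clash A -> worst_case A <= k -> t n <= k.
Proof.
move=> solA; apply: leq_trans; rewrite /t; case: ex_minnP => m _; apply.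
by apply/asboolP; exists A.
Qed.

Lemma wins_t (n k : nat) (T : strategy) : wins n k T [::] -> t n <= k.
Proof.
case/wins_sound=> A AP; apply: (@t_le _ _ A) => [s | ].
  by have [] := AP s [::] erefl.
by apply/bigmax_leqP => s _; have [] := AP s [::] erefl.
Qed.

Lemma evades_t (n k : nat) (T : evasion) (a : bitseq) :
  let st := [:: (nseq n false, a)] in
  legal n st -> evades n k T st -> k.+1 < t n.
Proof.
move=> st st_ok ev; rewrite /t; case: ex_minnP => m /asboolP[A solA <-] _.
case: A solA => [|u f] solA.
  by case: (solA [ffun=> zerov n]) => [[]|[? [? []]]].
rewrite ltnNge; apply/negP => /bigmax_leqP le_k.
(* With the first queried vertex [u] as origin, [u] becomes the zero word of [st]. *)
have u_st : (shift u u, a) \in st.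
  by rewrite shift_self mem_head.
have sza := legal_size st_ok u_st.
have [st' [st'_ok sub IH]] :=
  evades_sound u (f (Tuple sza)) st_ok ev.
have [s s_st'] := agrees_ex u st'_ok.
have su : s u = Tuple sza by exact/val_inj/s_st'/sub.
apply: (legal_not_found st'_ok s_st' _ (solA s)) => v.
rewrite /= inE su => /predU1P[-> | ].
  by apply/mapP; exists (shift u u, a) => //; apply: sub.
apply: IH => //; rewrite -ltnS -su; exact: le_k.
Qed.

Theorem lemma26 : t 4 = 7.
Proof.
apply/eqP; rewrite eqn_leq (wins_t strategy4_wins).
(* Surviving five queries after the first gives [6 < t 4]. *)
exact: (evades_t _ evasion4_evades).
Qed.
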